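(* Let $\mathcal{H}$ be a separable Hilbert space, let $L>0$, and let $f:\mathcal{H}\to\mathcal{H}$ satisfy $\langle f(x)-f(y),x-y\rangle\ge L|x-y|^2$ for all $x,y\in\mathcal{H}$. Let $g:\mathcal{H}\to\mathcal{H}$, $g(x):=f(x)-Lx$. Suppose that $\sup_{x\in B_r(x_0)}|g(x)|\le R$ for some $x_0\in\mathcal{H}$, $r\ge 2$, $R>0$. Then the function $\bar f_{R,r,x_0}:\mathcal{H}\to\mathcal{H}$ given by $$\bar f_{R,r,x_0}(x):=\tilde g_{R,r,x_0}(x)+Lx,$$ where $\tilde g_{R,r,x_0}$ is the truncation of $g$ defined in the context, has the following properties: (i) $\bar f_{R,r,x_0}(x)=f(x)$ for every $x\in B_{r-2}(x_0)$. (ii) $|\bar f_{R,r,x_0}(x)|\le R\,(1+\min\{r,|x-x_0|\})+L|x|$ for every $x\in\mathcal{H}$. (iii) If $f$ is Lipschitz on $B_r(x_0)$, then $\bar f_{R,r,x_0}$ is globally Lipschitz and $Lip(\bar f_{R,r,x_0})\le Lip_{B_r(x_0)}(g)+Rr+L$. (iv) $\langle\bar f_{R,r,x_0}(x)-\bar f_{R,r,x_0}(y),x-y\rangle\ge L|x-y|^2$ for all $x,y\in\mathcal{H}$.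
   Context: $\mathcal{H}$ is a separable (finite or infinite dimensional) Hilbert space with inner product $\langle\cdot,\cdot\rangle$ and norm $|\cdot|$. $B_r(x)$ denotes the open ball of radius $r$ around $x$ (so $B_0(x)=\emptyset$). For $A\subset\mathcal{H}$, $Lip_A(f):=\sup_{x,y\in A,\,x\ne y}\frac{|f(x)-f(y)|}{|x-y|}$; $f$ is called Lipschitz on $A$ if $Lip_A(f)<\infty$, and $Lip(f):=Lip_{\mathcal{H}}(f)$. Truncation: for $g:\mathcal{H}\to\mathcal{H}$, $R>0$, $r\ge2$, $x_0\in\mathcal{H}$, set $\tilde g_{R,r,x_0}(x):=t(x)g(x)+R\,s(x)(x-x_0)$, where $$t(x)=\begin{cases}1,& |x-x_0|\le r-1,\\ r-|x-x_0|,& r-1<|x-x_0|<r,\\ 0,& |x-x_0|\ge r,\end{cases}\qquad s(x)=\begin{cases}0,&|x-x_0|\le r-2,\\ |x-x_0|-r+2,& r-2<|x-x_0|<r-1,\\ 1,& r-1\le|x-x_0|\le r,\\ \frac{r}{|x-x_0|},&|x-x_0|\ge r.\end{cases}$$ *)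

(* Defs.v *)
From HB Require Import structures.
From mathcomp Require Import all_boot all_order all_algebra.
From mathcomp Require Import all_classical all_reals all_analysis.

Set Implicit Arguments.
Unset Strict Implicit.
Unset Printing Implicit Defensive.

Import Order.TTheory GRing.Theory Num.Theory.
Import numFieldNormedType.Exports.

Local Open Scope classical_set_scope.
Local Open Scope ring_scope.

Definition separable (T : topologicalType) : Prop :=
  exists2 A : set T, countable A & dense A.

(* A real Hilbert space is a complete normed K-module H together with a
   positive definite symmetric bilinear form [ip] which induces its norm. *)
Definition induces_norm (K : realType) (H : normedModType K)
    (ip : {dot H for idfun}) : Prop :=
  forall x : H, ip x x = `|x| ^+ 2.

(* The supremum is taken in [0, +oo]: the maximum with 0 only matters when A
   has at most one point, where it gives 0 instead of the supremum -oo of the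
   empty set in the extended reals. *)
Definition Lip (K : realType) (H : normedModType K) (A : set H)
    (f : H -> H) : \bar K :=
  maxe 0%E (ereal_sup
    [set q | exists x y, [/\ A x, A y, x != y &
                            q = (`|f x - f y| / `|x - y|)%:E]]).

Definition lipschitz_in (K : realType) (H : normedModType K) (A : set H)
    (f : H -> H) : Prop :=
  (Lip A f < +oo)%E.

Definition cutoff_t (K : realType) (H : normedModType K) (r : K) (x0 x : H) : K :=
  if `|x - x0| <= r - 1 then 1
  else if `|x - x0| < r then r - `|x - x0|
  else 0.

Definition cutoff_s (K : realType) (H : normedModType K) (r : K) (x0 x : H) : K :=
  if `|x - x0| <= r - 2 then 0
  else if `|x - x0| < r - 1 then `|x - x0| - r + 2
  else if `|x - x0| <= r then 1
  else r / `|x - x0|.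

Definition truncation (K : realType) (H : normedModType K) (g : H -> H)
    (R r : K) (x0 x : H) : H :=
  cutoff_t r x0 x *: g x + (R * cutoff_s r x0 x) *: (x - x0).

(* Main.v *)
(** With [a = |x - x0|] and [b = |y - x0|], take [b <= a]. Multiplying the
    monotone (resp. Lipschitz) map [g] by the cutoff [t] costs at most
    [R * (t b - t a) * |x - y|] (resp. [R * (t b - t a)]), since
    [t x g x - t y g y = t x (g x - g y) - (t y - t x) g y].
    The radial field [s(x) (x - x0)] pays for this: polarization expresses the
    inner product of its increment with [x - y], and the norm of its increment,
    through [a], [b] and [|x - y|], and this reduces both estimates to scalar
    inequalities between the piecewise rational profiles [t] and [s]. *)

Require Import Defs.
From HB Require Import structures.
From mathcomp Require Import all_boot all_order all_algebra.
From mathcomp Require Import all_classical all_reals all_analysis.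
From mathcomp Require Import ring lra.

Import Order.TTheory GRing.Theory Num.Theory.
Import numFieldNormedType.Exports.

Local Open Scope classical_set_scope.
Local Open Scope ring_scope.

(** * Scalar inequalities between the radial profiles of the two cutoffs *)

Section RadialProfiles.
Context {K : realFieldType} (r : K).
Implicit Types a b : K.

Definition profile_t a : K :=
  if a <= r - 1 then 1 else if a < r then r - a else 0.

Definition profile_s a : K :=
  if a <= r - 2 then 0
  else if a < r - 1 then a - r + 2
  else if a <= r then 1
  else r / a.

(* On [a > r] the quotient [s = r / a] is described by [s * a = r]. *)
Variant profile_spec a : K -> K -> Prop :=
| ProfileInner of a <= r - 2 : profile_spec a 1 0
| ProfileRamp of r - 2 <= a & a <= r - 1 : profile_spec a 1 (a - r + 2)
| ProfileFade of r - 1 <= a & a <= r : profile_spec a (r - a) 1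
| ProfileOuter s of r <= a & s * a = r & 0 <= s & s <= 1 : profile_spec a 0 s.

(** The formulas agree at the breakpoints by continuity, so closed ranges can be used and each
    inequality below splits into polynomial cases. *)
Lemma profileP a : 2 <= r -> profile_spec a (profile_t a) (profile_s a).
Proof.
move=> r2; rewrite /profile_t /profile_s.
case: (leP a (r - 2)) => a2.
  have -> : a <= r - 1 by lra.
  exact: ProfileInner.
case: (ltgtP a (r - 1)) => a1.
- by apply: ProfileRamp; lra.
- case: (ltgtP a r) => ar.
  + by apply: ProfileFade; lra.
  + have a_gt0 : 0 < a by lra.
    apply: ProfileOuter; first exact: ltW.
    * by rewrite divfK// gt_eqF.
    * by apply: divr_ge0; lra.
    * by rewrite ler_pdivrMr// mul1r ltW.
  + by rewrite -[0](subrr r) -{2}ar; apply: ProfileFade; lra.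
- have -> : a <= r by lra.
  have {1}-> : 1 = r - a by lra.
  by apply: ProfileFade; lra.
Qed.

Lemma profile_t_itv a : 2 <= r -> 0 <= profile_t a <= 1.
Proof. by move=> r2; case: (profileP a r2) => *; apply/andP; split; lra. Qed.

Lemma profile_s_itv a : 2 <= r -> 0 <= profile_s a <= 1.
Proof. by move=> r2; case: (profileP a r2) => *; apply/andP; split; lra. Qed.

Lemma profile_t_eq0 a : 2 <= r -> r <= a -> profile_t a = 0.
Proof. by move=> r2; case: (profileP a r2) => *; lra. Qed.

Lemma profile_t_le b a : 2 <= r -> b <= a -> profile_t a <= profile_t b.
Proof.
by move=> r2; case: (profileP a r2) => *; case: (profileP b r2) => *; lra.
Qed.

Lemma profile_t_lip b a : 2 <= r -> b <= a -> profile_t b - profile_t a <= a - b.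
Proof.
by move=> r2; case: (profileP a r2) => *; case: (profileP b r2) => *; lra.
Qed.

(** On the fade [s a * a = a] rises exactly as fast as [t] falls; elsewhere [t] is constant and
    [s a * a] does not decrease. *)
Lemma profile_sM_growth b a : 2 <= r -> 0 <= b -> b <= a ->
  profile_t b - profile_t a <= profile_s a * a - profile_s b * b.
Proof.
by move=> r2; case: (profileP a r2) => *; case: (profileP b r2) => *; nra.
Qed.

(** The slope of [s a * a - t a] reaches its maximum [r] at the end of the ramp, equals 2 on the
    fade, and vanishes in the two other ranges. *)
Lemma profile_sM_lip b a : 2 <= r -> 0 <= b -> b <= a ->
  profile_s a * a - profile_s b * b + (profile_t b - profile_t a)
    <= r * (a - b).
Proof.
by move=> r2; case: (profileP a r2) => *; case: (profileP b r2) => *; nra.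
Qed.

(** The term [s a * (a - b)] suffices. If the left side is positive then [a > r - 1]; on the fade
    [s a = 1] and [t] is 1-Lipschitz, and beyond it [s a * (a - b) >= r - b >= t b]. *)
Lemma profile_sD_ge b a : 2 <= r -> 0 <= b -> b <= a ->
  profile_t b - profile_t a <= (profile_s a + profile_s b) * (a - b).
Proof.
by move=> r2; case: (profileP a r2) => *; case: (profileP b r2) => *; nra.
Qed.

Lemma profile_le a : 2 <= r -> 0 <= a ->
  profile_t a + profile_s a * a <= 1 + Num.min r a.
Proof.
by move=> r2; case: (profileP a r2) => *; rewrite -lerBlDl le_min;
  apply/andP; split; nra.
Qed.

End RadialProfiles.

(** * Inner product identities and estimates for the radial field *)

Section InnerProduct.
Context {K : realType} {H : normedModType K} {ip : {dot H for idfun}}.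
Hypothesis ip_norm : induces_norm ip.
Implicit Types (u v w : H) (c d : K).

Lemma ipC u v : ip u v = ip v u.
Proof. by rewrite hermC /= expr0 mul1r. Qed.

Lemma ipDl u v w : ip (u + v) w = ip u w + ip v w.
Proof. exact: linearDl. Qed.

Lemma ipBl u v w : ip (u - v) w = ip u w - ip v w.
Proof. exact: linearBl. Qed.

Lemma ipBr u v w : ip u (v - w) = ip u v - ip u w.
Proof. exact: linearBr. Qed.

Lemma ipZl c u v : ip (c *: u) v = c * ip u v.
Proof. exact: linearZl_LR. Qed.

Lemma ipZr c u v : ip u (c *: v) = c * ip u v.
Proof. exact: linearZr_LR. Qed.

Lemma ip_polarization u v :
  ip u v = (`|u| ^+ 2 + `|v| ^+ 2 - `|u - v| ^+ 2) / 2.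
Proof.
rewrite -!ip_norm ipBl !ipBr (ipC v u).
by field.
Qed.

(** Half of Cauchy-Schwarz: by polarization it is the squared triangle inequality. *)
Lemma ip_ge u v : - (`|u| * `|v|) <= ip u v.
Proof.
rewrite ip_polarization.
have := ler_normB u v; have := normr_ge0 (u - v).
have := normr_ge0 u; have := normr_ge0 v.
nra.
Qed.

(** Separates an angular part from a radial one: [|u - v|^2 - (|u| - |v|)^2] equals
    [2 * (|u| * |v| - ip u v)], which is nonnegative. *)
Lemma ip_scaled_sub c d u v :
  ip (c *: u - d *: v) (u - v)
    = (c + d) / 2 * (`|u - v| ^+ 2 - (`|u| - `|v|) ^+ 2)
      + (c * `|u| - d * `|v|) * (`|u| - `|v|).
Proof.
rewrite ipBl !ipBr !ipZl !ip_norm (ipC v u).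
by rewrite ip_polarization; field.
Qed.

Lemma sqr_norm_scaled_sub c d u v :
  `|c *: u - d *: v| ^+ 2
    = c * d * (`|u - v| ^+ 2 - (`|u| - `|v|) ^+ 2)
      + (c * `|u| - d * `|v|) ^+ 2.
Proof.
rewrite -[LHS]ip_norm ipBl !ipBr !ipZl !ipZr.
by rewrite !ip_norm (ipC v u) ip_polarization; field.
Qed.

Section Cutoff.
Variables (r : K) (u v : H).
Hypotheses (r_ge2 : 2 <= r) (vu : `|v| <= `|u|).

Let s := profile_s r.
Let t := profile_t r.
Let D_ge : `|u| - `|v| <= `|u - v|.
Proof. exact: lerB_dist. Qed.

(* Writing [D = |u - v|], [d = |u| - |v|], [tau = t |v| - t |u|], growth of
   [s a * a + t a] gives [LHS >= (s + s') / 2 * (D^2 - d^2) + tau * d], and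
   [tau <= (s + s') * d] makes the excess over [tau * D] a product of
   nonnegative factors. *)
Lemma ip_radial_sub_ge :
  (t `|v| - t `|u|) * `|u - v|
    <= ip (s `|u| *: u - s `|v| *: v) (u - v).
Proof.
rewrite ip_scaled_sub.
have r2 := r_ge2; have b_ge0 := normr_ge0 v.
have := profile_sM_growth r _ _ r2 b_ge0 vu; rewrite -/s -/t.
have := profile_sD_ge r _ _ r2 b_ge0 vu; rewrite -/s -/t.
have /andP[+ _] := profile_s_itv r `|u| r2; rewrite -/s.
have /andP[+ _] := profile_s_itv r `|v| r2; rewrite -/s.
move: D_ge vu.
set a := `|u|; set b := `|v|; set D := `|u - v| => Dd ba s'0 s0 tau1 tau2.
have h1 : 0 <= (s a * a - s b * b - (t b - t a)) * (a - b).
  by apply: mulr_ge0; lra.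
have h2 : 0 <= (D - (a - b)) * ((s a + s b) / 2 * (D + (a - b)) - (t b - t a)).
  apply: mulr_ge0; first lra.
  have : 0 <= (s a + s b) * (D - (a - b)) by apply: mulr_ge0; lra.
  by lra.
by lra.
Qed.

(** The subtracted difference of [t] leaves room for the fade of [g], which then adds nothing to the
    Lipschitz constant. The proof compares squares, bounding the radial part through
    [profile_sM_lip]. *)
Lemma norm_radial_sub_le :
  `|s `|u| *: u - s `|v| *: v| <= r * `|u - v| - (t `|v| - t `|u|).
Proof.
have r2 := r_ge2; have b_ge0 := normr_ge0 v.
have := profile_sM_growth r _ _ r2 b_ge0 vu; rewrite -/s -/t.
have := profile_sM_lip r _ _ r2 b_ge0 vu; rewrite -/s -/t.
have := profile_t_lip r _ _ r2 vu; rewrite -/s -/t.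
have := profile_t_le r _ _ r2 vu; rewrite -/s -/t.
have /andP[+ +] := profile_s_itv r `|u| r2; rewrite -/s.
have /andP[+ +] := profile_s_itv r `|v| r2; rewrite -/s.
have := sqr_norm_scaled_sub (s `|u|) (s `|v|) u v.
move: D_ge vu.
set N := `|_ *: u - _|.
set a := `|u|; set b := `|v|; set D := `|u - v|.
move=> Dd ba NE s'0 s'1 s0 s1 tau0 tau1 lip growth.
set tau := t b - t a in tau0 tau1 lip growth *.
have tau_ge0 : 0 <= tau by rewrite /tau; lra.
have rhs_ge0 : 0 <= r * D - tau by nra.
rewrite -(@ler_pXn2r _ 2) ?nnegrE ?normr_ge0// NE.
have tau_le : 0 <= r * (a - b) - tau by lra.
have psi2 : (s a * a - s b * b) ^+ 2 <= (r * (a - b) - tau) ^+ 2.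
  have psi_ge0 : 0 <= s a * a - s b * b by lra.
  by rewrite ler_pXn2r//; lra.
have ss'1 : s a * s b <= 1 by nra.
(* This product is [(r * D - tau)^2 - (r * (a - b) - tau)^2] minus the angular part of [N^2]. Its
   second factor is the sum of the four terms in [h2] to [h5]. *)
have h1 : 0 <= (D - (a - b)) *
    (r * (r * (D + (a - b)) - 2 * tau) - s a * s b * (D + (a - b))).
  apply: mulr_ge0; first lra.
  have h2 : 0 <= (1 - s a * s b) * (D + (a - b)) by apply: mulr_ge0; lra.
  have h3 : 0 <= r * (2 * (a - b) - 2 * tau) by apply: mulr_ge0; lra.
  have h4 : 0 <= (r * r - r - 1) * (D + (a - b)) by apply: mulr_ge0; nra.
  have h5 : 0 <= r * (D - (a - b)) by apply: mulr_ge0; lra.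
  lra.
lra.
Qed.

End Cutoff.
End InnerProduct.

(** * Extended-real Lipschitz constants as pointwise bounds *)

Section LipBound.
Context {K : realType} {H : normedModType K}.
Implicit Types (A : set H) (h : H -> H).

Lemma LipP A h (M : K) : 0 <= M ->
  (Lip A h <= M%:E)%E <->
  (forall x y, A x -> A y -> `|h x - h y| <= M * `|x - y|).
Proof.
move=> M_ge0; rewrite /Lip ge_max lee_fin M_ge0 /=; split.
- move=> /ereal_supP supM x y Ax Ay; have [->|xy] := eqVneq x y.
    by rewrite !subrr !normr0 mulr0.
  rewrite -ler_pdivrMr ?normr_gt0 ?subr_eq0// -lee_fin.
  by apply: supM; exists x, y.
- move=> hM; apply: ge_ereal_sup => _ [x [y [Ax Ay xy ->]]].
  by rewrite lee_fin ler_pdivrMr ?normr_gt0 ?subr_eq0//; exact: hM.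
Qed.

Lemma lipschitz_in_fin A h : lipschitz_in A h ->
  exists2 M, 0 <= M & Lip A h = M%:E.
Proof.
rewrite /lipschitz_in; have : (0 <= Lip A h)%E by rewrite /Lip le_max lexx.
by case: (Lip A h) => // M; rewrite lee_fin; exists M.
Qed.

(** Serves to pass finiteness from [f] to [g]; the final bound uses [Lip] of [g] itself. *)
Lemma lipschitz_inB_scale A h (L : K) : 0 <= L -> lipschitz_in A h ->
  lipschitz_in A (fun x => h x - L *: x).
Proof.
move=> L_ge0 /lipschitz_in_fin[M M_ge0 hM].
suff : (Lip A (fun x => h x - L *: x)%R <= (M + L)%:E)%E.
  by move=> /le_lt_trans; apply; exact: ltry.
have /LipP-/(_ M_ge0) lipM : (Lip A h <= M%:E)%E by rewrite hM.
apply/LipP; first exact: addr_ge0.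
move=> x y Ax Ay.
have -> : h x - L *: x - (h y - L *: y) = (h x - h y) - L *: (x - y).
  by rewrite scalerBr !opprB [L *: y - h y]addrC addrACA [L *: y - _]addrC.
rewrite mulrDl (le_trans (ler_normB _ _))// lerD ?lipM//.
by rewrite normrZ ger0_norm.
Qed.

End LipBound.

(** * Agreement, growth, monotonicity and Lipschitz bound of the truncated map *)

Section Truncation.
Context {K : realType} {H : normedModType K} {ip : {dot H for idfun}}.
Hypothesis ip_norm : induces_norm ip.
Variables (g : H -> H) (x0 : H) (r R : K).
Hypotheses (r_ge2 : 2 <= r) (R_ge0 : 0 <= R).
Hypothesis g_le : forall x, ball x0 r x -> `|g x| <= R.
Implicit Types x y : H.

Local Notation t x := (profile_t r `|x - x0|).
Local Notation s x := (profile_s r `|x - x0|).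
Local Notation trunc := (truncation g R r x0).

Lemma in_ball_norm x (e : K) : ball x0 e x = (`|x - x0| < e) :> Prop.
Proof. by rewrite -ball_normE /ball_/= distrC. Qed.

Lemma cutoff_in_ball x : t x != 0 -> ball x0 r x.
Proof.
move=> tx; rewrite in_ball_norm ltNge; apply: contraNN tx => rx.
by apply/eqP; exact: profile_t_eq0.
Qed.

(** Outside the ball, where [g] is uncontrolled, [c <= t x] forces [c = 0]. *)
Lemma norm_scaled_le c x : 0 <= c -> c <= t x -> `|c *: g x| <= R * c.
Proof.
move=> c_ge0 ctx; rewrite normrZ ger0_norm// mulrC.
have [->|c_neq0] := eqVneq c 0; first by rewrite !mulr0.
rewrite ler_wpM2r// g_le//; apply: cutoff_in_ball.
by rewrite gt_eqF// (lt_le_trans _ ctx)// lt_def c_neq0.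
Qed.

Lemma truncationE x : trunc x = t x *: g x + (R * s x) *: (x - x0).
Proof. by []. Qed.

(* The part with [t y - t x] is bounded through [g y] alone, so that [g x] only
   matters when [t x != 0], i.e. when both points lie in the ball. *)
Lemma truncation_sub x y :
  trunc x - trunc y = t x *: (g x - g y) - (t y - t x) *: g y
                + R *: (s x *: (x - x0) - s y *: (y - x0)).
Proof.
rewrite !truncationE !scalerBr scalerBl !scalerA opprD addrACA; congr (_ + _).
by rewrite opprB addrA subrK.
Qed.

Lemma truncation_inner x : ball x0 (r - 2) x -> trunc x = g x.
Proof.
rewrite in_ball_norm => /ltW xr2; have xr1 : `|x - x0| <= r - 1 by lra.
by rewrite truncationE /profile_t /profile_s xr1 xr2 scale1r mulr0 scale0r addr0.
Qed.

Lemma norm_truncation_le x : `|trunc x| <= R * (1 + Num.min r `|x - x0|).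
Proof.
have /andP[t_ge0 _] := profile_t_itv r `|x - x0| r_ge2.
have /andP[s_ge0 _] := profile_s_itv r `|x - x0| r_ge2.
apply: (le_trans (ler_normD _ _)).
apply: (@le_trans _ _ (R * (t x + s x * `|x - x0|))); last first.
  by rewrite ler_wpM2l// profile_le.
rewrite mulrDr lerD ?norm_scaled_le//.
by rewrite normrZ mulrA ger0_norm// mulr_ge0.
Qed.

Lemma truncation_monotone :
  (forall x y, 0 <= ip (g x - g y) (x - y)) ->
  forall x y, 0 <= ip (trunc x - trunc y) (x - y).
Proof.
move=> g_mono x y; wlog yx : x y / `|y - x0| <= `|x - x0|.
  move=> wl; have [|/ltW] := leP `|y - x0| `|x - x0|; first exact: wl.
  move=> /wl; rewrite -[trunc y - trunc x]opprB -[y - x]opprB.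
  by rewrite linearNl linearNr opprK.
have /andP[t_ge0 _] := profile_t_itv r `|x - x0| r_ge2.
have tyx : 0 <= t y - t x by rewrite subr_ge0 profile_t_le.
have xyE : x - y = (x - x0) - (y - x0) by rewrite opprB addrA subrK.
have radial := ip_radial_sub_ge ip_norm r (x - x0) (y - x0) r_ge2 yx.
rewrite -xyE in radial.
(* Cauchy-Schwarz loses at most what [radial], scaled by [R], gives back. *)
have fade := ip_ge ip_norm (- ((t y - t x) *: g y)) (x - y).
have fade_le : `|- ((t y - t x) *: g y)| * `|x - y| <= R * (t y - t x) * `|x - y|.
  by rewrite normrN ler_wpM2r// norm_scaled_le// lerBlDr lerDl.
have main : 0 <= t x * ip (g x - g y) (x - y) by rewrite mulr_ge0.
have {}radial := ler_wpM2l R_ge0 radial.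
rewrite truncation_sub ipDl [ip (_ *: _ - _) _]ipDl !ipZl.
lra.
Qed.

Lemma truncation_lipschitz (M : K) : 0 <= M ->
  (forall x y, ball x0 r x -> ball x0 r y ->
    `|g x - g y| <= M * `|x - y|) ->
  forall x y, `|trunc x - trunc y| <= (M + R * r) * `|x - y|.
Proof.
move=> M_ge0 g_lip x y; wlog yx : x y / `|y - x0| <= `|x - x0|.
  move=> wl; have [|/ltW] := leP `|y - x0| `|x - x0|; first exact: wl.
  by move=> /wl; rewrite distrC (distrC y).
have /andP[t_ge0 t_le1] := profile_t_itv r `|x - x0| r_ge2.
have tyx : 0 <= t y - t x by rewrite subr_ge0 profile_t_le.
have xyE : x - y = (x - x0) - (y - x0) by rewrite opprB addrA subrK.
have radial := norm_radial_sub_le ip_norm r (x - x0) (y - x0) r_ge2 yx.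
rewrite -xyE in radial.
have fade : `|(t y - t x) *: g y| <= R * (t y - t x).
  by rewrite norm_scaled_le// lerBlDr lerDl.
have main : `|t x *: (g x - g y)| <= M * `|x - y|.
  (* If [t x] is nonzero, [x] lies in the ball, and so does [y], being no farther from [x0]. *)
  have [->|tx] := eqVneq (t x) 0; first by rewrite scale0r normr0 mulr_ge0.
  have xB := cutoff_in_ball _ tx.
  have yB : ball x0 r y.
    by move: xB; rewrite !in_ball_norm; exact: le_lt_trans.
  rewrite normrZ ger0_norm// (le_trans _ (g_lip _ _ xB yB))//.
  by rewrite ler_piMl.
rewrite truncation_sub.
apply: (le_trans (ler_normD _ _)); rewrite normrZ ger0_norm//.
(* The cost [R * (t y - t x)] of the fade cancels against the term subtracted in [radial]. *)
have := ler_wpM2l R_ge0 radial.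
have := ler_normB (t x *: (g x - g y)) ((t y - t x) *: g y).
lra.
Qed.

End Truncation.

Theorem corollary2p2 (K : realType) (H : completeNormedModType K)
    (ip : {dot H for idfun}) (ip_norm : induces_norm ip)
    (H_separable : separable H)
    (L : K) (L_gt0 : 0 < L) (f : H -> H)
    (f_monotone : forall x y : H,
        ip (f x - f y) (x - y) >= L * `|x - y| ^+ 2)
    (x0 : H) (r R : K) (r_ge2 : 2 <= r) (R_gt0 : 0 < R) :
  let g : H -> H := fun x => f x - L *: x in
  (ereal_sup [set `|g x|%:E | x in ball x0 r] <= R%:E)%E ->
  let fbar : H -> H := fun x => truncation g R r x0 x + L *: x in
  [/\ forall x : H, ball x0 (r - 2) x -> fbar x = f x,
      forall x : H,
        `|fbar x| <= R * (1 + Num.min r `|x - x0|) + L * `|x|,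
      lipschitz_in (ball x0 r) f ->
        lipschitz_in [set: H] fbar /\
        (Lip [set: H] fbar <= Lip (ball x0 r) g + (R * r + L)%:E)%E
    & forall x y : H,
        ip (fbar x - fbar y) (x - y) >= L * `|x - y| ^+ 2].
Proof.
move=> g /ereal_supP supg fbar.
have R_ge0 := ltW R_gt0; have L_ge0 := ltW L_gt0.
have g_le x : ball x0 r x -> `|g x| <= R.
  by move=> xB; rewrite -lee_fin; apply: supg; exists x.
have gE x y : g x - g y = (f x - f y) - L *: (x - y).
  by rewrite /g opprD addrACA -opprD scalerBr.
have fbarE x y : fbar x - fbar y =
    (truncation g R r x0 x - truncation g R r x0 y) + L *: (x - y).
  by rewrite /fbar opprD addrACA -scalerBr.
split.
- by move=> x xB; rewrite /fbar truncation_inner// subrK.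
- move=> x; rewrite /fbar (le_trans (ler_normD _ _))// lerD//.
    exact: norm_truncation_le.
  by rewrite normrZ ger0_norm.
- move=> f_lip.
  have /lipschitz_in_fin[M M_ge0 gM] : lipschitz_in (ball x0 r) g.
    exact: lipschitz_inB_scale.
  have /LipP-/(_ M_ge0) g_lip : (Lip (ball x0 r) g <= M%:E)%E by rewrite gM.
  have bound_ge0 : 0 <= M + (R * r + L).
    by rewrite !addr_ge0// mulr_ge0//; lra.
  have fbar_lip : (Lip [set: H] fbar <= (M + (R * r + L))%:E)%E.
    apply/LipP => // x y _ _; rewrite fbarE (le_trans (ler_normD _ _))//.
    rewrite addrA mulrDl lerD// ?normrZ ?ger0_norm//.
    exact: (truncation_lipschitz ip_norm).
  split; last by rewrite gM -EFinD.
  by apply: le_lt_trans fbar_lip _; exact: ltry.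
(* Removing [L *: x] from [f] turns strong monotonicity into plain monotonicity of [g]; adding it
   back after truncation restores the constant [L]. *)
- have g_mono x y : 0 <= ip (g x - g y) (x - y).
    by rewrite gE ipBl ipZl ip_norm subr_ge0.
  move=> x y; rewrite fbarE ipDl ipZl ip_norm lerDr.
  exact: truncation_monotone.
Qed.
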